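(* Let $\mathcal X$ be a Banach lattice with order unit $\mathbf e$ and the norm induced by $\mathbf e$, and let $\mathcal Q\subset\mathcal X'$ be a non-empty, closed, convex set for which there is a closed subspace $\mathcal H_{\mathcal Q}\subset\mathcal X$ with $\mathcal Q=\mathcal H_{\mathcal Q}^\perp\cap\partial B'_+$. Then for every $f\in\mathcal X$, $$\mathbf P(f;\mathcal Q)=\mathbf D(f;\mathcal H_{\mathcal Q}+\mathcal X_-).$$
   Context: $\mathcal X$ is a real Banach lattice with an order unit $\mathbf e\in\mathcal X_+$ and norm $\|f\|_{\mathcal X}=\inf\{c\in\mathbb R: -c\,\mathbf e\le f\le c\,\mathbf e\}$; $\mathcal X_-=\{f\in\mathcal X: f\le 0\}$. $\mathcal X'$ is the topological dual with the dual order. $\partial B'_+=\{\eta\in\mathcal X'_+:\eta(\mathbf e)=1\}$ is the positive part of the unit sphere of $\mathcal X'$. $\mathcal H^\perp=\{\eta\in\mathcal X':\eta(h)=0\ \forall h\in\mathcal H\}$. For $f\in\mathcal X$: $$\mathbf P(f;\mathcal Q)=\sup_{\eta\in\mathcal Q}\eta(f),$$ $$\mathbf D(f;\mathcal H_{\mathcal Q}+\mathcal X_-)=\inf\{c\in\mathbb R:\exists\, k\in\mathcal H_{\mathcal Q}+\mathcal X_-\text{ with } c\,\mathbf e+k=f\}=\inf\{c\in\mathbb R:\exists\,h\in\mathcal H_{\mathcal Q}\text{ with }c\,\mathbf e+h\ge f\}.$$ *)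

(* Defs.v *)
From HB Require Import structures.
From mathcomp Require Import all_boot all_order all_algebra.
From mathcomp Require Import all_classical all_reals all_analysis.

Set Implicit Arguments.
Unset Strict Implicit.
Unset Printing Implicit Defensive.

Import Order.TTheory GRing.Theory Num.Theory numFieldNormedType.Exports.

Local Open Scope classical_set_scope.
Local Open Scope ring_scope.

(* HB rejects a structure that inherits from both normed modules and lattices
   (their joins with the substructures of numDomainType are not declared), so
   the two are packed by hand and the library instances, with the order in
   ring_display, are attached to the carrier projection. *)
Record latticeNormedMod (R : realType) := LatticeNormedMod {
  lnm_sort :> Type ;
  lnm_normed : CompleteNormedModule.axioms_ R lnm_sort ;
  lnm_le : rel lnm_sort ;
  lnm_le_refl : reflexive lnm_le ;
  lnm_le_anti : antisymmetric lnm_le ;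
  lnm_le_trans : transitive lnm_le ;
  lnm_meet : lnm_sort -> lnm_sort -> lnm_sort ;
  lnm_join : lnm_sort -> lnm_sort -> lnm_sort ;
  lnm_meetP : forall x y z,
    lnm_le x (lnm_meet y z) = lnm_le x y && lnm_le x z ;
  lnm_joinP : forall x y z,
    lnm_le (lnm_join x y) z = lnm_le x z && lnm_le y z
}.

HB.instance Definition _ (R : realType) (X : latticeNormedMod R) :=
  CompleteNormedModule.copy (lnm_sort X)
    (CompleteNormedModule.Pack (lnm_normed X)).

HB.instance Definition _ (R : realType) (X : latticeNormedMod R) :=
  Order.Le_isPOrder.Build ring_display (lnm_sort X)
    (@lnm_le_refl R X) (@lnm_le_anti R X) (@lnm_le_trans R X).

HB.instance Definition _ (R : realType) (X : latticeNormedMod R) :=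
  Order.POrder_MeetJoin_isLattice.Build ring_display (lnm_sort X)
    (@lnm_meetP R X) (@lnm_joinP R X).

Definition lattice_abs (R : realType) (X : latticeNormedMod R) (x : X) : X :=
  Order.join x (- x).

Record banachLattice (R : realType) := BanachLattice {
  bl_sort :> latticeNormedMod R ;
  bl_lerD2r : forall x y z : bl_sort, x <= y -> x + z <= y + z ;
  bl_ler_wpZ2l : forall (a : R) (x y : bl_sort),
    0 <= a -> x <= y -> a *: x <= a *: y ;
  bl_ler_norm : forall x y : bl_sort,
    lattice_abs x <= lattice_abs y -> `|x| <= `|y|
}.

Section TopologicalDual.
Context (R : realType) (V : normedModType R).

Definition dual_pred : {pred V -> R^o} :=
  [pred f | `[< linear f /\ continuous f >]].

Record dual := Dual { dual_fun :> V -> R^o ; _ : dual_fun \in dual_pred }.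

HB.instance Definition _ := [isSub for dual_fun].
HB.instance Definition _ := [Choice of dual by <:].

Lemma dual_submod_closed : submod_closed dual_pred.
Proof.
split.
  apply/asboolP; split; first by move=> a x y; rewrite /= scaler0 addr0.
  exact: cst_continuous.
move=> a f g /asboolP[lf cf] /asboolP[lg cg]; apply/asboolP; split.
  move=> b x y; rewrite !fctE lf lg !scalerDr !scalerA mulrC.
  by rewrite addrACA.
move=> x; apply: cvgD; last exact: cg.
by apply: cvgZr; exact: cf.
Qed.

HB.instance Definition _ :=
  GRing.isSubmodClosed.Build R (V -> R^o) dual_pred dual_submod_closed.
HB.instance Definition _ := [SubChoice_isSubLmodule of dual by <:].

Definition dual_norm (f : dual) : R :=
  sup [set `|f x| | x in [set x : V | `|x| <= 1]].

Lemma dual_linear (f : dual) : linear f.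
Proof. by have /asboolP[] := valP f. Qed.

HB.instance Definition _ (f : dual) :=
  GRing.isLinear.Build R V R^o _ (dual_fun f) (dual_linear f).

Lemma dual_continuous (f : dual) : continuous f.
Proof. by have /asboolP[] := valP f. Qed.

Lemma dual_norm_has_sup (f : dual) :
  has_sup [set `|f x| | x in [set x : V | `|x| <= 1]].
Proof.
split; first by exists `|f 0|; exists 0; rewrite //= normr0.
have /linear_bounded_continuous/bounded_funP/(_ 1)[M fM] := @dual_continuous f.
by exists M => _ /= [x x1 <-]; exact: fM.
Qed.

Lemma dual_norm_ub (f : dual) (x : V) : `|x| <= 1 -> `|f x| <= dual_norm f.
Proof.
by move=> x1; apply: sup_upper_bound; [exact: dual_norm_has_sup|exists x].
Qed.

Lemma dual_norm_le (f : dual) (c : R) :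
  (forall x, `|x| <= 1 -> `|f x| <= c) -> dual_norm f <= c.
Proof.
move=> fc; apply: ge_sup; first by case: (dual_norm_has_sup f).
by move=> _ [x x1 <-]; exact: fc.
Qed.

Lemma dual_normD (f g : dual) : dual_norm (f + g) <= dual_norm f + dual_norm g.
Proof.
apply: dual_norm_le => x x1; rewrite (le_trans (ler_normD _ _))//.
by rewrite lerD// dual_norm_ub.
Qed.

Lemma dual_normZ_le (a : R) (f : dual) :
  dual_norm (a *: f) <= `|a| * dual_norm f.
Proof.
by apply: dual_norm_le => x x1; rewrite normrM ler_wpM2l// dual_norm_ub.
Qed.

Lemma dual_norm_eq0 (f : dual) : dual_norm f = 0 -> f = 0.
Proof.
move=> f0; apply/val_inj/funext => x /=.
have [->|x0] := eqVneq x 0; first by rewrite linear0.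
have := @dual_norm_ub f (`|x|^-1 *: x).
rewrite normrZ normfV normr_id mulVf ?normr_eq0// lexx => /(_ isT).
rewrite f0 normr_le0 linearZ /= mulf_eq0 invr_eq0 normr_eq0 (negPf x0) /=.
by move/eqP.
Qed.

Lemma dual_normZ (a : R) (f : dual) : dual_norm (a *: f) = `|a| * dual_norm f.
Proof.
apply/eqP; rewrite eq_le dual_normZ_le /=.
have [->|a0] := eqVneq a 0.
  rewrite normr0 mul0r (le_trans (normr_ge0 ((0 *: f : dual) 0)))//.
  by rewrite dual_norm_ub// normr0.
rewrite -ler_pdivlMl ?normr_gt0// -normfV.
by rewrite -[leLHS](congr1 dual_norm (scalerK a0 f)) dual_normZ_le.
Qed.

HB.instance Definition _ :=
  Lmodule_isNormed.Build R dual dual_normD dual_normZ dual_norm_eq0.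

End TopologicalDual.

Section Duality.
Context (R : realType) (X : banachLattice R).

Definition order_unit (e : X) :=
  0 <= e /\ forall f : X, exists c : R, - (c *: e) <= f <= c *: e.

(* The infima and suprema below are taken in \bar R, so that no convention is
   needed for unbounded or empty sets. *)
Definition order_unit_norm (e : X) := forall f : X,
  (`|f|)%:E =
    ereal_inf [set c%:E | c in [set c : R | - (c *: e) <= f <= c *: e]].

Definition nonpos_cone : set X := [set f | f <= 0].

Definition dual_nonneg : set (dual X) :=
  [set eta | forall f : X, 0 <= f -> 0 <= eta f].

Definition dual_sphere_nonneg (e : X) : set (dual X) :=
  dual_nonneg `&` [set eta | eta e = 1].

Definition annihilator (H : set X) : set (dual X) :=
  [set eta | forall h, H h -> eta h = 0].

Definition primal (f : X) (Q : set (dual X)) : \bar R :=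
  ereal_sup [set (eta f)%:E | eta in Q].

Definition dual_value (e f : X) (K : set X) : \bar R :=
  ereal_inf [set c%:E | c in [set c : R | exists2 k, K k & c *: e + k = f]].

Definition set_add (A B : set X) : set X :=
  [set a + b | a in A & b in B].

End Duality.

Arguments nonpos_cone {R} X _ : assert.

(* Main.v *)
From HB Require Import structures.
Require Import Defs.
From mathcomp Require Import all_boot all_order all_algebra.
From mathcomp Require Import all_classical all_reals all_analysis.
From mathcomp Require Import lra.

(** Call [c] a superhedging cost of [x] if [x <= c *: e + h] for some [h] in
    [H], and let [pi x] be the infimum of these costs; [pi f] is the dual
    value of [f].  An element [eta] of [Q] is monotone, vanishes on [H] and
    takes the value 1 at [e], so it sends such an inequality to [eta x <= c].
    Thus [eta <= pi] for every [eta] in [Q], which is the inequality primal <=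
    dual.  Since [Q] has an element and [e] is an order unit, this also shows
    that [pi] is finite everywhere.

    For the other inequality it suffices to find one [eta] in [Q] with
    [eta f = pi f].  The costs form a convex cone in [X * R], so [pi] is
    sublinear, and the Hahn-Banach theorem ([sublinear_support]) gives a linear
    [L <= pi] with [L f = pi f].  Everything required of [L] follows from
    [L <= pi], by exhibiting costs: if [0 <= y] then 0 is a cost of [- y], so
    [0 <= L y]; if [h] is in [H] then 0 is a cost of [h] and of [- h], so
    [L h = 0]; and 1 and -1 are costs of [e] and [- e], so [L e = 1].  Finally,
    positivity and [L e = 1] force [`|L x| <= `|x|] because the norm is the
    one induced by [e], so [L] is continuous.

    Hahn-Banach itself is obtained without extending functionals from
    subspaces: by Zorn's lemma there is a minimal sublinear functional below
    any given one, and a minimal sublinear functional is linear.  Both this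
    fact and the equality at [a] come from [sublinear_lower_slope], which
    lowers a sublinear [q] to a sublinear [r] with [r (- a) <= - q a]. *)

Import Order.TTheory GRing.Theory Num.Theory numFieldNormedType.Exports.

Local Open Scope classical_set_scope.
Local Open Scope ring_scope.

(** * Sublinear functionals and the Hahn-Banach theorem *)

(** Positive homogeneity is stated as an inequality because this is what an
    infimum satisfies immediately; equality follows on replacing the factor by
    its inverse, see [sublinearZ]. *)
Definition sublinear {R : realType} {V : lmodType R} (q : V -> R) :=
  (forall x y, q (x + y) <= q x + q y) /\
  (forall a x, 0 < a -> q (a *: x) <= a * q x).

Section Sublinear.
Context {R : realType} {V : lmodType R}.
Implicit Types (p q : V -> R) (x y a : V).

Lemma sublinearZ q : sublinear q ->
  forall (t : R) x, 0 <= t -> q (t *: x) = t * q x.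
Proof.
move=> [_ qZ] t x; rewrite le_eqVlt => /predU1P[<-|t0].
  rewrite scale0r mul0r.
  have := qZ 2 0 (ltr0Sn _ _); rewrite scaler0.
  have := qZ 2^-1 0; rewrite scaler0 invr_gt0 => /(_ (ltr0Sn _ _)).
  lra.
apply/eqP; rewrite eq_le qZ//= -ler_pdivlMl//.
by have := qZ t^-1 (t *: x); rewrite invr_gt0 scalerK ?gt_eqF//; apply.
Qed.

Lemma sublinear0 q : sublinear q -> q 0 = 0.
Proof. by move=> /sublinearZ/(_ 0 0 (lexx _)); rewrite scale0r mul0r. Qed.

Lemma sublinear_ge_oppN q x : sublinear q -> - q (- x) <= q x.
Proof.
move=> qS; have := qS.1 x (- x); rewrite subrr sublinear0//; lra.
Qed.

Lemma sublinear_odd_linear q : sublinear q ->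
  (forall x, q (- x) <= - q x) -> linear (q : V -> R^o).
Proof.
move=> qS qN.
have qNE x : q (- x) = - q x.
  by have := qN x; have := sublinear_ge_oppN q x qS; lra.
have qD x y : q (x + y) = q x + q y.
  have := qS.1 x y; have := qS.1 (- x) (- y); rewrite -opprD !qNE; lra.
move=> t x y; rewrite qD; congr (_ + _).
have [t0|/ltW t0] := leP 0 t; first exact: sublinearZ.
rewrite -[t]opprK scaleNr qNE sublinearZ ?oppr_ge0//.
by rewrite [RHS]mulNr.
Qed.

(** The three sublinear functionals of the proof (the lowered slope, the
    infimum of a chain, the superhedging price) are of this form.  [S]
    is a convex cone in [V * R] given by its vertical sections; adding or
    scaling near-optimal elements of the sections gives both inequalities. *)
Lemma inf_cone_sublinear (S : V -> set R) :
  (forall x, has_inf (S x)) ->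
  (forall x y u v, S x u -> S y v -> S (x + y) (u + v)) ->
  (forall (t : R) x u, 0 < t -> S x u -> S (t *: x) (t * u)) ->
  sublinear (fun x => inf (S x)).
Proof.
move=> Sinf SD SZ; split=> [x y|t x t0].
  apply/ler_addgt0Pr => eps eps0.
  have e2 : 0 < eps / 2 by rewrite divr_gt0.
  have [u Su ultx] := inf_adherent e2 (Sinf x).
  have [v Sv vlty] := inf_adherent e2 (Sinf y).
  have := ge_inf (Sinf (x + y)).2 (SD _ _ _ _ Su Sv); lra.
rewrite -ler_pdivrMl//; apply: lb_le_inf (Sinf x).1 _ => u Su.
by rewrite ler_pdivrMl//; exact: (ge_inf (Sinf (t *: x)).2 (SZ _ _ _ t0 Su)).
Qed.

(** The functional [r x] is the infimum over [t >= 0] of [q (x + t a) - t q a].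
    Taking [t = 0] gives [r <= q], and [t = 1] at [- a] gives
    [r (- a) <= q 0 - q a]. *)
Lemma sublinear_lower_slope q a : sublinear q ->
  exists2 r, sublinear r & (forall x, r x <= q x) /\ r (- a) <= - q a.
Proof.
move=> qS.
pose S x := [set u : R | exists2 t : R, 0 <= t & q (x + t *: a) - t * q a <= u].
have Slb x : lbound (S x) (- q (- x)).
  move=> u [t t0]; apply: le_trans.
  by have := qS.1 (x + t *: a) (- x); rewrite addrC addKr sublinearZ//; lra.
have Sq x : S x (q x).
  by exists 0 => //; rewrite scale0r addr0 mul0r subr0.
have Sinf x : has_inf (S x) by split; [exists (q x)|exists (- q (- x))].
exists (fun x => inf (S x)); last split=> [x|].
- apply: inf_cone_sublinear => //
    [x y u v [s s0 su] [t t0 tv]|k x u k0 [t t0 tu]].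
    exists (s + t); first exact: addr_ge0.
    have := qS.1 (x + s *: a) (y + t *: a).
    rewrite addrACA -scalerDl; lra.
  exists (k * t); first by rewrite mulr_ge0// ltW.
  rewrite -scalerA -scalerDr (sublinearZ q qS _ _ (ltW k0)) -mulrA -mulrBr.
  by rewrite ler_pM2l.
- exact: (ge_inf (Sinf x).2 (Sq x)).
- apply: (ge_inf (Sinf _).2); exists 1 => //.
  by rewrite scale1r addNr sublinear0// mul1r sub0r.
Qed.

(** Zorn's lemma applies because the pointwise infimum of a chain of sublinear
    functionals below [p] is again sublinear; it is finite since each [q] of
    the chain satisfies [q x >= - q (- x) >= - p (- x)]. *)
Lemma sublinear_minimal p : sublinear p ->
  exists2 q, sublinear q /\ (forall x, q x <= p x) &
    forall r, sublinear r -> (forall x, r x <= q x) -> forall x, q x <= r x.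
Proof.
move=> pS.
pose T := {q : V -> R | sublinear q /\ forall x, q x <= p x}.
pose above (q r : T) := `[< forall x, sval r x <= sval q x >].
pose p0 : T := exist _ p (conj pS (fun x => lexx (p x))).
have [|||q qmin] := @ZL_preorder T p0 above.
- by move=> q; apply/asboolP.
- move=> q r s /asboolP qr /asboolP rs; apply/asboolP => x.
  exact: le_trans (rs x) (qr x).
- move=> C totC.
  (* the empty chain is bounded by [p] itself *)
  have [[q0 Cq0]|C0] := pselect (C !=set0); last first.
    by exists p0 => q Cq; case: C0; exists q.
  pose S x := [set u : R | exists2 q, C q & sval q x <= u].
  have Slb x : lbound (S x) (- p (- x)).
    move=> u [[q [qS qp]] _ /=]; apply: le_trans.
    by apply: le_trans (sublinear_ge_oppN q x qS); rewrite lerN2.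
  have Sq (q : T) x : C q -> S x (sval q x) by exists q.
  have Sinf x : has_inf (S x).
    by split; [exists (sval q0 x); exact: Sq|exists (- p (- x))].
  have SS : sublinear (fun x => inf (S x)).
    apply: inf_cone_sublinear => //
      [x y u v [q Cq qu] [r Cr rv]|k x u k0 [q Cq qu]].
      (* the smaller of the two members bounds both values *)
      have [/asboolP qr|/asboolP rq] := totC _ _ Cq Cr.
        exists r => //; have := (svalP r).1.1 x y; have := qr x; lra.
      exists q => //; have := (svalP q).1.1 x y; have := rq y; lra.
    exists q => //; apply: le_trans ((svalP q).1.2 _ _ k0) _.
    by rewrite ler_pM2l.
  have Sle (q : T) x : C q -> inf (S x) <= sval q x.
    by move=> Cq; apply: (ge_inf (Sinf x).2 (Sq _ _ Cq)).
  have Sp x : inf (S x) <= p x.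
    by apply: le_trans (Sle q0 x Cq0) ((svalP q0).2 x).
  exists (exist _ (fun x => inf (S x)) (conj SS Sp) : T) => q Cq.
  by apply/asboolP => x; exact: Sle.
exists (sval q); first exact: (svalP q).
move=> r rS rq x.
have rp y : r y <= p y by apply: le_trans (rq y) ((svalP q).2 y).
have /asboolP : above (exist _ r (conj rS rp) : T) q.
  by apply: qmin; apply/asboolP.
exact.
Qed.

(** Hahn-Banach.  Minimality forces [L (- x) <= - L x] for all [x], hence
    linearity.  Minimizing below the functional [r] lowered along [a], rather
    than below [p], gives [L (- a) <= r (- a) <= - p a] and so [L a = p a]. *)
Lemma sublinear_support p a : sublinear p ->
  exists2 L : {linear V -> R^o}, forall x, L x <= p x & L a = p a.
Proof.
move=> /[dup] pS /(sublinear_lower_slope p a)[r rS [rp ra]].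
have [L [LS Lr] Lmin] := sublinear_minimal r rS.
have LN x : L (- x) <= - L x.
  have [s sS [sL sx]] := sublinear_lower_slope L x LS.
  exact: le_trans (Lmin s sS sL (- x)) sx.
have Llin := sublinear_odd_linear L LS LN.
have Lp x : L x <= p x by apply: le_trans (Lr x) (rp x).
pose L' : {linear V -> R^o} :=
  HB.pack (L : V -> R^o) (GRing.isLinear.Build R V R^o _ L Llin).
exists L' => //=.
apply/eqP; rewrite eq_le Lp /=.
by have := Lr (- a); have := sublinear_ge_oppN L (- a) LS; rewrite opprK; lra.
Qed.

End Sublinear.

(** * Order and positive functionals on a Banach lattice *)

Section BanachLattice.
Context {R : realType} {X : banachLattice R}.
Implicit Types (x y e f : X) (H : set X) (eta : dual X).

Lemma bl_lerD x y z w : x <= y -> z <= w -> x + z <= y + w.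
Proof.
move=> xy zw; apply: le_trans (bl_lerD2r z xy) _.
by rewrite ![y + _]addrC; exact: bl_lerD2r.
Qed.

Lemma bl_subr_ge0 x y : (0 <= y - x) = (x <= y).
Proof.
apply/idP/idP => [/(bl_lerD2r x)|/(bl_lerD2r (- x))].
  by rewrite add0r subrK.
by rewrite subrr.
Qed.

Lemma dual_nonneg_le eta x y : dual_nonneg eta -> x <= y -> eta x <= eta y.
Proof.
by move=> eta0 xy; rewrite -subr_ge0 -linearB; apply: eta0; rewrite bl_subr_ge0.
Qed.

Lemma mem_set_add_nonpos e f H (c : R) :
  (exists2 k, set_add H (nonpos_cone X) k & c *: e + k = f) <->
  (exists2 h, H h & f <= c *: e + h).
Proof.
split=> [[_ [h Hh [n n0 <-]] <-]|[h Hh fle]].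
  by exists h => //; rewrite addrA -[leRHS]addr0; exact: bl_lerD.
exists (f - c *: e); last by rewrite addrC subrK.
exists h => //; exists (f - (c *: e + h)).
  by rewrite /nonpos_cone /= -bl_subr_ge0 sub0r opprB bl_subr_ge0.
by rewrite addrC opprD addrA subrK.
Qed.

(** Any [c] with [- (c *: e) <= x <= c *: e] satisfies [- c <= L x <= c], and
    the norm of [x] is the infimum of such [c]. *)
Lemma positive_unital_le_norm e (L : {linear X -> R^o}) : order_unit_norm e ->
  (forall x, 0 <= x -> 0 <= L x) -> L e = 1 ->
  forall x, `|L x| <= `|x|.
Proof.
move=> e_norm L0 Le x; rewrite -lee_fin e_norm.
have Lle y z : y <= z -> L y <= L z.
  move=> yz; rewrite -subr_ge0 -linearB.
  by apply: L0; rewrite bl_subr_ge0.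
have LZ c : L (c *: e) = c.
  by rewrite linearZ /= Le /GRing.scale /= mulr1.
apply: le_ereal_inf_tmp => _ [c /= /andP[cx xc] <-]; rewrite lee_fin ler_norml.
have := Lle _ _ xc; have := Lle _ _ cx.
by rewrite linearN /= LZ => -> ->.
Qed.

Lemma positive_unital_dual e (L : {linear X -> R^o}) : order_unit_norm e ->
  (forall x, 0 <= x -> 0 <= L x) -> L e = 1 ->
  exists2 eta : dual X, dual_sphere_nonneg e eta & eta = L :> (X -> R).
Proof.
move=> e_norm L0 Le.
have Lcont : continuous L.
  apply: bounded_linear_continuous; apply/bounded_funP => r; exists r => x.
  exact/le_trans/positive_unital_le_norm.
have Ldual : (L : X -> R^o) \in @dual_pred R X.
  by apply/asboolP; split=> //; exact: linearP.
by exists (Dual Ldual).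
Qed.

(** * The superhedging price *)

Definition superhedging_costs e H x : set R :=
  [set c | exists2 h, H h & x <= c *: e + h].

Definition superhedging_price e H x : R := inf (superhedging_costs e H x).

(** The functional [eta] serves to bound the costs from below: without an
    element of the annihilator in the positive part of the dual sphere the
    infimum of the costs could be -oo. *)
Section SuperhedgingPrice.
Context (e : X) (e_unit : order_unit e) (H : set X).
Context (H_sub : submod_closed (mem H)).
Context (eta : dual X) (etaH : annihilator H eta)
  (etaS : dual_sphere_nonneg e eta).

Let H0 : H 0.
Proof. by have [/set_mem] := H_sub. Qed.

Let HZD (t : R) h k : H h -> H k -> H (t *: h + k).
Proof. by move=> /mem_set Hh /mem_set Hk; apply/set_mem/H_sub.2. Qed.

Lemma superhedging_weak_duality x c : superhedging_costs e H x c -> eta x <= c.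
Proof.
move=> [h Hh /(dual_nonneg_le _ _ _ etaS.1)].
by rewrite linearD linearZ /= (etaH h Hh) etaS.2 addr0 /GRing.scale /= mulr1.
Qed.

Lemma superhedging_has_inf x : has_inf (superhedging_costs e H x).
Proof.
split; last by exists (eta x) => c; exact: superhedging_weak_duality.
by have [c /andP[_ xc]] := e_unit.2 x; exists c; exists 0; rewrite ?addr0.
Qed.

Lemma superhedging_price_le x c :
  superhedging_costs e H x c -> superhedging_price e H x <= c.
Proof. exact: (ge_inf (superhedging_has_inf x).2). Qed.

Lemma superhedging_price_sublinear : sublinear (superhedging_price e H).
Proof.
apply: inf_cone_sublinear => [x|x y u v|t x u t0].
- exact: superhedging_has_inf.
- move=> [h Hh xh] [k Hk yk]; exists (h + k); last first.
    by rewrite scalerDl addrACA; exact: bl_lerD.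
  by have := HZD 1 h k Hh Hk; rewrite scale1r.
- move=> [h Hh xh]; exists (t *: h).
    by have := HZD t h 0 Hh H0; rewrite addr0.
  by rewrite -scalerA -scalerDr; apply: bl_ler_wpZ2l => //; exact: ltW.
Qed.

(** Below the price, a linear functional is bounded by every cost; the proof
    exhibits the costs of [- y] for [0 <= y], of [h] and [- h] in [H], and of
    [e] and [- e] that place the supporting functional at [x] in the annihilator
    and in the positive part of the dual sphere. *)
Lemma superhedging_price_attained (e_norm : order_unit_norm e) x :
  exists2 mu : dual X, annihilator H mu /\ dual_sphere_nonneg e mu &
    mu x = superhedging_price e H x.
Proof.
have [L Lp Lx] :=
  sublinear_support (superhedging_price e H) x superhedging_price_sublinear.
have Lle y c : superhedging_costs e H y c -> L y <= c.
  by move=> /superhedging_price_le; exact: le_trans (Lp y).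
have L0 y : 0 <= y -> 0 <= L y.
  move=> y0; rewrite -oppr_le0 -linearN; apply: Lle; exists 0 => //.
  by rewrite scale0r addr0 -bl_subr_ge0 opprK add0r.
have LH h : H h -> L h = 0.
  move=> Hh; apply/eqP; rewrite eq_le; apply/andP; split.
    by apply: Lle; exists h => //; rewrite scale0r add0r.
  rewrite -oppr_le0 -linearN; apply: Lle; exists (- h).
    by have := HZD (-1) h 0 Hh H0; rewrite addr0 scaleN1r.
  by rewrite scale0r add0r.
have Le : L e = 1.
  apply/eqP; rewrite eq_le; apply/andP; split.
    by apply: Lle; exists 0 => //; rewrite scale1r addr0.
  rewrite -lerN2 -linearN; apply: Lle; exists 0 => //.
  by rewrite scaleN1r addr0.
have [mu muS muE] := positive_unital_dual e L e_norm L0 Le.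
by exists mu; [split=> // h Hh; rewrite muE; exact: LH|rewrite muE].
Qed.

End SuperhedgingPrice.

Lemma dual_valueE e H x :
  has_inf (superhedging_costs e H x) ->
  dual_value e x (set_add H (nonpos_cone X)) = (superhedging_price e H x)%:E.
Proof.
move=> [S0 Slb]; rewrite -ereal_inf_EFin//; congr (ereal_inf (_ @` _)).
by apply/seteqP; split=> c /mem_set_add_nonpos.
Qed.

End BanachLattice.

Theorem corollary4p2 (R : realType) (X : banachLattice R) (e : X)
    (e_unit : order_unit e) (e_norm : order_unit_norm e)
    (Q : set (dual X)) (Q_neq0 : Q !=set0) (Q_closed : closed Q)
    (Q_convex : convex_set Q)
    (H : set X) (H_sub : submod_closed (mem H)) (H_closed : closed H)
    (QE : Q = annihilator H `&` dual_sphere_nonneg e) (f : X) :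
  primal f Q = dual_value e f (set_add H (nonpos_cone X)).
Proof.
move: Q_neq0; rewrite QE => -[eta0 [eta0H eta0S]].
have Sinf := superhedging_has_inf e e_unit H H_sub eta0 eta0H eta0S f.
rewrite dual_valueE//; apply/eqP; rewrite eq_le; apply/andP; split.
  apply: ge_ereal_sup => _ [eta [etaH etaS] <-]; rewrite lee_fin.
  apply: lb_le_inf Sinf.1 _ => c; exact: superhedging_weak_duality.
have [mu muQ <-] :=
  superhedging_price_attained e e_unit H H_sub eta0 eta0H eta0S e_norm f.
by apply: ereal_sup_ubound; exists mu.
Qed.
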